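(* (a) Let $a_1,a_2,b_1,b_2,c_1,c_2$ be positive integers, put $a=a_1+a_2$, $b=b_1+b_2$, $c=c_1+c_2$ and $$\ell'=b_1c_1+b_1c_2+b_2c_2,\qquad m'=a_1c_1+a_2c_1+a_2c_2,\qquad n'=a_1b_1+a_1b_2+a_2b_2,$$ and $e'=\gcd(\ell',m',n')$. Then $a_1,a_2,b_1,b_2,c_1,c_2$ arise through (H1) from some numerical semigroup $\Gamma=\langle\ell,m,n\rangle$ if and only if $e'=1$. In this case, $(\ell,m,n)=(\ell',m',n')$. (b) Let $a,b,c$ be positive integers, let $a_1,b_2\in\mathbb{N}$, and define $\ell',m',n',d'$ by $$\ell'=bd',\qquad m'=ad',\qquad \frac{n'}{d'}=\frac{a_1b+ab_2}{c},\quad \gcd(n',d')=1,\quad d'\ge1 .$$ Then $a,b,c,a_1,b_2$ arise through (H2) from some numerical semigroup $\Gamma=\langle\ell,m,n\rangle$ if and only if $(\ell',m',n')$ is in the corresponding subcase of (H2), $$\gcd(a,b)=1,$$ and $$\gcd(-a_1+qa,\;-b_2-qb,\;c)=1\quad\text{for all integers } q\in[-b_2/b,\;a_1/a].$$ In this case, $(\ell,m,n)=(\ell',m',n')$.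
   Context: $\mathbb{N}=\{0,1,2,\dots\}$. A triple of positive integers $\ell,m,n$ with $\gcd(\ell,m,n)=1$ generates the numerical semigroup $\Gamma=\langle\ell,m,n\rangle\subset\mathbb{N}$. Given such a triple, let $a$ (resp. $b$, $c$) be the minimal positive integer such that $$a\ell=b_1m+c_2n,\qquad bm=a_2\ell+c_1n,\qquad cn=a_1\ell+b_2m$$ for some $a_1,a_2,b_1,b_2,c_1,c_2\in\mathbb{N}$. By Herzog there are two cases. (H1): $0\notin\{a_1,a_2,b_1,b_2,c_1,c_2\}$. Then $a=a_1+a_2$, $b=b_1+b_2$, $c=c_1+c_2$, and the three relations $a\ell=b_1m+c_2n$, $bm=a_2\ell+c_1n$, $cn=a_1\ell+b_2m$ are the unique minimal relations of $\ell,m,n$. Positive integers $a_1,a_2,b_1,b_2,c_1,c_2$ ''arise through (H1) from $\Gamma=\langle\ell,m,n\rangle$'' if they are the coefficients obtained in this way from $(\ell,m,n)$. (H2): $0\in\{a_1,a_2,b_1,b_2,c_1,c_2\}$. Then one of $(a,-b,0)$, $(a,0,-c)$, $(0,b,-c)$ is a minimal relation of $\ell,m,n$ (a relation $(u,v,w)$ meaning $u\ell+vm+wn=0$). In the subcase where $(a,-b,0)$ is a relation (the others being obtained by permuting the variables), the minimal relations are $a\ell=bm$ and $a_1\ell+b_2m=cn$, where the second relation, with coefficients written $(-a_1,-b_2,c)$, is unique up to adding multiples of $(a,-b,0)$ (keeping $a_1,b_2\in\mathbb{N}$). Integers $a,b,c\ge1$, $a_1,b_2\in\mathbb{N}$ ''arise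 through (H2) from $\Gamma=\langle\ell,m,n\rangle$'' if $(\ell,m,n)$ is in case (H2), $a$, $b$, $c$ are the minimal positive integers such that $a\ell\in\langle m,n\rangle$, $bm\in\langle\ell,n\rangle$, $cn\in\langle\ell,m\rangle$, respectively, and $a\ell=bm$, $a_1\ell+b_2m=cn$. The triple $(\ell',m',n')$ ''is in the corresponding subcase of (H2)'' if it is in case (H2) and, with $a'$ and $b'$ denoting the minimal positive integers such that $a'\ell'\in\langle m',n'\rangle$ and $b'm'\in\langle\ell',n'\rangle$, one has the minimal relation $a'\ell'=b'm'$. *)

(* Defs.v *)
From mathcomp Require Import all_boot all_order all_algebra.

Set Implicit Arguments.
Unset Strict Implicit.
Unset Printing Implicit Defensive.

(* k \in <x, y>, the submonoid of nat generated by x and y. *)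
Definition in_span2 (x y k : nat) : Prop :=
  exists u v : nat, k = u * x + v * y.

(* k is the minimal positive integer such that k * x \in <y, z>. *)
Definition min_multiple (x y z k : nat) : Prop :=
  [/\ 0 < k, in_span2 y z (k * x)
    & forall j : nat, 0 < j -> in_span2 y z (j * x) -> k <= j].

(* <l, m, n> is a numerical semigroup, with (l, m, n) as chosen generators;
   the generating system is not required to be minimal. *)
Definition numsemigroup_gens (l m n : nat) : Prop :=
  [/\ 0 < l, 0 < m, 0 < n & gcdn (gcdn l m) n = 1].

Definition min_multiples (l m n a b c : nat) : Prop :=
  [/\ min_multiple l m n a, min_multiple m l n b & min_multiple n l m c].

(* The identities a = a1 + a2, b = b1 + b2, c = c1 + c2, valid in case (H1),
   are consequences and not part of the definition. *)
Definition herzog_coeffs (l m n a1 a2 b1 b2 c1 c2 : nat) : Prop :=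
  numsemigroup_gens l m n /\
  exists a b c : nat,
    [/\ min_multiples l m n a b c,
        a * l = b1 * m + c2 * n,
        b * m = a2 * l + c1 * n
      & c * n = a1 * l + b2 * m].

Definition arises_H1 (l m n a1 a2 b1 b2 c1 c2 : nat) : Prop :=
  herzog_coeffs l m n a1 a2 b1 b2 c1 c2 /\
  0 \notin [:: a1; a2; b1; b2; c1; c2].

Definition case_H2 (l m n : nat) : Prop :=
  exists a1 a2 b1 b2 c1 c2 : nat,
    herzog_coeffs l m n a1 a2 b1 b2 c1 c2 /\
    0 \in [:: a1; a2; b1; b2; c1; c2].

Definition arises_H2 (l m n a b c a1 b2 : nat) : Prop :=
  [/\ case_H2 l m n, min_multiples l m n a b c,
      a * l = b * m & a1 * l + b2 * m = c * n].

(* The subcase of (H2) in which (a, -b, 0) is a relation; it is a minimal one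
   because a and b are the minimal multiples. *)
Definition subcase_H2 (l m n : nat) : Prop :=
  case_H2 l m n /\
  exists a b : nat,
    [/\ min_multiple l m n a, min_multiple m l n b & a * l = b * m].

(* Main.v *)
Require Import Defs.
From mathcomp Require Import all_boot all_order all_algebra.
From mathcomp Require Import zify ring.

Import Order.TTheory GRing.Theory Num.Theory.

(** Both parts are about the lattice L of integer relations (u, v, w),
    u l + v m + w n = 0.

    In (H1) the three relations give the vectors r1 = (a, -b1, -c2),
    r2 = (-a2, b, -c1), r3 = (-a1, -b2, c) of L. Minimality of a, b, c forces
    r1 + r2 + r3 = 0 ([coeff_sum]). As (l, m, n) is orthogonal to L, the cross
    product r1 x r2 = (l', m', n') is a multiple e (l, m, n). The point is that
    e = 1, that is, r1 and r2 generate L. The half-open parallelogram on r1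
    and r2 is covered by the triangles (0, r1, -r3) and (0, r2, -r3); by the signs
    of the coordinates, a further point of L in one of them would be a relation
    expressing a smaller multiple of one generator by the other two
    ([triangle_no_lattice_point]). So L has no point outside Z r1 + Z r2
    with a nonzero multiple inside it ([relations_saturated]); since
    a2 r1 + a r2 = e (0, n, -m), and similarly in the other coordinates, e
    divides all the coefficients, and then r1 / e contradicts minimality of a
    unless e = 1 ([herzog_H1_gens]). Conversely, if gcd(l', m', n') = 1, every
    relation w = (j, -u, -v) with j > 0 and u, v >= 0 has
    w x r2 = s (l', m', n') and r3 x w = s' (l', m', n') with positive integers
    s, s', and j = s a1 + s' a2 >= a ([herzog_min_multiple]).

    In (H2), minimality of a makes a and b coprime, so l = b d and m = a d with
    d = gcd(l, m), and n / d is determined by c n = a1 l + b2 m and is in lowest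
    terms as gcd(l, m, n) = 1 ([arises_H2_gens]). A common divisor g > 1 of
    a1 - q a, b2 + q b and c would give a relation for (c / g) n ([arises_H2_gcd]).
    Conversely, minimality of b in the corresponding subcase puts n' in <a, b>
    ([generator_in_span]), whence d' is the least positive multiplier taking n'
    into <l', m'> ([min_multiple_d]) and c = k d'. Comparing the two expressions
    of k n' in <a, b> shows that k divides a1 - q a, b2 + q b and c for some
    admissible q, and the gcd condition gives k = 1. *)

(** * Case (H1): from the semigroup to the formulas *)

(** The (H1) data with the minimal multiples named: in this form it is visibly
    invariant under the symmetries of the three generators, which leave only
    one inequality of each kind to be proved. *)
Definition positive_herzog (l m n a b c a1 a2 b1 b2 c1 c2 : nat) : Prop :=
  [/\ [/\ 0 < l, 0 < m & 0 < n],
      min_multiples l m n a b c,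
      [/\ a * l = b1 * m + c2 * n,
          b * m = a2 * l + c1 * n
        & c * n = a1 * l + b2 * m]
    & [/\ 0 < a1 /\ 0 < a2, 0 < b1 /\ 0 < b2 & 0 < c1 /\ 0 < c2]].

Lemma in_span2C x y k : in_span2 x y k -> in_span2 y x k.
Proof. by case=> u [v ->]; exists v, u; rewrite addnC. Qed.

Lemma min_multipleC x y z k : min_multiple x y z k -> min_multiple x z y k.
Proof.
by case=> k0 /in_span2C kS kmin; split=> // j j0 /in_span2C; apply: kmin.
Qed.

Lemma positive_herzog_rot {l m n a b c a1 a2 b1 b2 c1 c2} :
  positive_herzog l m n a b c a1 a2 b1 b2 c1 c2 ->
  positive_herzog m n l b c a b1 b2 c1 c2 a1 a2.
Proof.
case=> -[l0 m0 n0] [mina minb minc] [R1 R2 R3] [a0 b0 c0].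
split=> //; first by split=> //; apply: min_multipleC.
by split; rewrite // addnC.
Qed.

Lemma positive_herzog_mirror {l m n a b c a1 a2 b1 b2 c1 c2} :
  positive_herzog l m n a b c a1 a2 b1 b2 c1 c2 ->
  positive_herzog m l n b a c b2 b1 a2 a1 c2 c1.
Proof.
case=> -[l0 m0 n0] [mina minb minc] [R1 R2 R3] [[? ?] [? ?] [? ?]].
by split=> //; split=> //; [apply: min_multipleC | rewrite addnC].
Qed.

(** If a <= a1, replacing a l by b1 m + c2 n in the relation for c n gives
    c n = (a1 - a) l + (b1 + b2) m + c2 n. As b1 m > 0, c2 < c, and then
    (c - c2) n contradicts the minimality of c. *)
Lemma coeff_lt {l m n a b c a1 a2 b1 b2 c1 c2} :
  positive_herzog l m n a b c a1 a2 b1 b2 c1 c2 -> a1 < a.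
Proof.
case=> -[l0 m0 n0] [_ _ [c0 _ minc]] [R1 R2 R3] [[? ?] [? ?] [? ?]].
rewrite ltnNge; apply/negP=> le_a.
have [ltc|lec] := ltnP c2 c.
  have: c <= c - c2 by apply: minc; [lia | exists (a1 - a), (b2 + b1); nia].
  by lia.
by nia.
Qed.

(** The sum of the relations for b m and c n has (a1 + a2) l on one side and,
    as b2 < b and c1 < c, nonnegative multiples of m and n on the other. *)
Lemma coeff_sum_ge {l m n a b c a1 a2 b1 b2 c1 c2} :
  positive_herzog l m n a b c a1 a2 b1 b2 c1 c2 -> a <= a1 + a2.
Proof.
move=> H.
have ltb2 := coeff_lt (positive_herzog_mirror H).
have ltc1 := coeff_lt (positive_herzog_rot (positive_herzog_rot H)).
case: H => -[l0 m0 n0] [[_ _ mina] _ _] [R1 R2 R3] [[? ?] [? ?] [? ?]].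
by apply: mina; [lia | exists (b - b2), (c - c1); nia].
Qed.

(** The three relations sum to
    (a1 + a2 - a) l + (b1 + b2 - b) m + (c1 + c2 - c) n = 0, whose terms are
    nonnegative. *)
Lemma coeff_sum {l m n a b c a1 a2 b1 b2 c1 c2} :
  positive_herzog l m n a b c a1 a2 b1 b2 c1 c2 ->
  [/\ a = a1 + a2, b = b1 + b2 & c = c1 + c2].
Proof.
move=> H.
have lea := coeff_sum_ge H.
have leb := coeff_sum_ge (positive_herzog_rot H).
have lec := coeff_sum_ge (positive_herzog_rot (positive_herzog_rot H)).
case: H => -[l0 m0 n0] _ [R1 R2 R3] _.
have {lea leb lec} [[i ai] [j bj] [k ck]] :
    [/\ exists i, a1 + a2 = a + i, exists j, b1 + b2 = b + j
      & exists k, c1 + c2 = c + k].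
  split; [exists (a1 + a2 - a) | exists (b1 + b2 - b) | exists (c1 + c2 - c)];
  lia.
have excess0 : i * l + j * m + k * n = 0.
  have := (congr1 (muln^~ l) ai, congr1 (muln^~ m) bj, congr1 (muln^~ n) ck).
  by move=> [[/= la mb] nc]; lia.
move/eqP: excess0; rewrite !addn_eq0 !muln_eq0.
by move=> /andP[/andP[/orP[] /eqP ? /orP[] /eqP ?] /orP[] /eqP ?]; split; lia.
Qed.

(** The multiplier of a primitive triple is read off without division: x times
    gcd(l, m, n) = 1 is gcd(x l, x m, x n) = gcd(x, y, z) l. *)
Lemma proportional_gcd {l m n x y z : nat} :
  gcdn (gcdn l m) n = 1 -> x * m = y * l -> x * n = z * l -> y * n = z * m ->
  [/\ x = gcdn (gcdn x y) z * l, y = gcdn (gcdn x y) z * m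
    & z = gcdn (gcdn x y) z * n].
Proof.
move=> g1 xm xn yn; split; rewrite !muln_gcdl.
- by rewrite -xm -xn -!muln_gcdr g1 muln1.
- by rewrite xm -yn -!muln_gcdr g1 muln1.
- by rewrite xn yn -!muln_gcdr g1 muln1.
Qed.

(** With (x, y, z) = (p r1 - q r3) / E this says that the triangle with vertices
    0, r1 and -r3, minus the side opposite to 0, meets L only in 0. In it the
    first coordinate is nonnegative and smaller than a, and the third one is
    nonpositive and larger than -c. So the relation expresses either -z n by l
    and m (if 0 <= y) or x l by m and n (if y < 0), and the minimality of c or
    of a is violated. *)
Lemma triangle_no_lattice_point {l m n a b c a1 a2 b1 b2 c1 c2} :
  positive_herzog l m n a b c a1 a2 b1 b2 c1 c2 ->
  forall E x y z p q : int,
  (0 <= p -> 0 <= q -> p + q < E ->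
   E * x = p * a%:Z + q * a1%:Z ->
   E * y = q * b2%:Z - p * b1%:Z ->
   E * z = - (p * c2%:Z) - q * c%:Z ->
   p = 0 /\ q = 0)%R.
Proof.
move=> H E x y z p q p0 q0 ltE Ex Ey Ez.
have [sa sb sc] := coeff_sum H.
case: H => -[l0 m0 n0] [[_ _ mina] _ [_ _ minc]] [R1 R2 R3].
move=> [[? ?] [? ?] [? ?]].
have E0 : (0 < E)%R by lia.
have R1z : (a%:Z * l%:Z - b1%:Z * m%:Z - c2%:Z * n%:Z = 0)%R by lia.
have R3z : (a1%:Z * l%:Z + b2%:Z * m%:Z - c%:Z * n%:Z = 0)%R by lia.
have rel : (x * l%:Z + y * m%:Z + z * n%:Z = 0)%R.
  apply: (@mulfI _ E); first by lia.
  transitivity (p * (a%:Z * l%:Z - b1%:Z * m%:Z - c2%:Z * n%:Z) +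
                q * (a1%:Z * l%:Z + b2%:Z * m%:Z - c%:Z * n%:Z))%R.
    by rewrite !mulrDr !mulrA Ex Ey Ez; ring.
  by rewrite R1z R3z !mulr0.
have ge0M (u : int) (v : nat) : (0 <= u -> 0 <= u * v%:Z)%R.
  by move=> u0; rewrite mulr_ge0.
have mul_lt (k : nat) : 0 < k -> ((p + q) * k%:Z < E * k%:Z)%R.
  by move=> k0; rewrite ltr_pM2r.
have {R1z R3z} [xn xE] : exists k : nat, (x = k%:Z)%R.
  exists `|x|%N; rewrite gez0_abs // -(pmulr_rge0 _ E0) Ex.
  by rewrite addr_ge0 ?ge0M.
have [y0|y0] := leP 0%R y.
  have [yn yE] : exists k : nat, (y = k%:Z)%R by exists `|y|%N; lia.
  have [z0|z0] := leP 0%R z.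
    have := mulr_ge0 (ltW E0) z0; rewrite Ez.
    have := ge0M p c2.-1 p0; have := ge0M q c.-1 q0.
    have -> : c2 = c2.-1.+1 :> nat by lia.
    have -> : c = c.-1.+1 :> nat by lia.
    by rewrite /= !intS !mulrDr !mulr1; lia.
  have [zn zE] : exists k : nat, z = (- k%:Z)%R by exists `|z|%N; lia.
  have lec : c <= zn.
    by apply: minc; [lia | exists xn, yn; move: rel; rewrite xE yE zE; lia].
  have := mul_lt c ltac:(lia).
  have := ge0M p c1 p0; have := mulr_ge0 (ltW E0) (_ : (0 <= zn%:Z - c%:Z)%R).
  by move=> /(_ ltac:(lia)); move: Ez; rewrite zE sc PoszD; lia.
have [yn yE] : exists k : nat, y = (- k%:Z)%R by exists `|y|%N; lia.
have [zn zE] : exists k : nat, z = (- k%:Z)%R.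
  exists `|z|%N; rewrite lez0_abs ?opprK // -(pmulr_rle0 _ E0) Ez.
  by rewrite -opprD oppr_le0 addr_ge0 ?ge0M.
have xn0 : 0 < xn.
  by rewrite lt0n; apply/eqP=> x00; move: rel; rewrite xE yE zE x00; nia.
have lea : a <= xn.
  by apply: mina; [lia | exists yn, zn; move: rel; rewrite xE yE zE; lia].
have := mul_lt a ltac:(lia).
have := ge0M q a2 q0; have := mulr_ge0 (ltW E0) (_ : (0 <= xn%:Z - a%:Z)%R).
by move=> /(_ ltac:(lia)); move: Ex; rewrite xE sa PoszD; lia.
Qed.
(** With (x, y, z) = (s r1 + t r2) / E: reducing s and t modulo E moves the
    point into the parallelogram of r1 and r2, where it lies in one of two
    triangles without nonzero lattice points. *)
Lemma relations_saturated {l m n a b c a1 a2 b1 b2 c1 c2} :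
  positive_herzog l m n a b c a1 a2 b1 b2 c1 c2 ->
  forall (E : nat) (x y z s t : int), 0 < E ->
  (E%:Z * x = s * a%:Z - t * a2%:Z ->
   E%:Z * y = t * b%:Z - s * b1%:Z ->
   E%:Z * z = - (s * c2%:Z) - t * c1%:Z ->
   (E%:Z %| s)%Z /\ (E%:Z %| t)%Z)%R.
Proof.
move=> H E x y z s t E0 Ex Ey Ez.
have [sa sb sc] := coeff_sum H.
have EZ : (E%:Z != 0)%R by lia.
have rs0 := modz_ge0 s EZ; have rt0 := modz_ge0 t EZ.
have rsE : ((s %% E%:Z)%Z < E%:Z)%R by rewrite ltz_pmod.
have rtE : ((t %% E%:Z)%Z < E%:Z)%R by rewrite ltz_pmod.
have sE := divz_eq s E%:Z; have tE := divz_eq t E%:Z.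
set rs := (s %% E%:Z)%Z in rs0 rsE sE; set rt := (t %% E%:Z)%Z in rt0 rtE tE.
set qs := (s %/ E%:Z)%Z in sE; set qt := (t %/ E%:Z)%Z in tE.
suff [rs00 rt00] : rs = 0%R /\ rt = 0%R.
  by split; apply/dvdz_mod0P.
pose x' := (x - qs * a%:Z + qt * a2%:Z)%R.
pose y' := (y - qt * b%:Z + qs * b1%:Z)%R.
pose z' := (z + qs * c2%:Z + qt * c1%:Z)%R.
have Ex' : (E%:Z * x' = rs * a%:Z - rt * a2%:Z)%R.
  by rewrite /x' !mulrDr Ex {1}sE {1}tE; ring.
have Ey' : (E%:Z * y' = rt * b%:Z - rs * b1%:Z)%R.
  by rewrite /y' !mulrDr Ey {1}sE {1}tE; ring.
have Ez' : (E%:Z * z' = - (rs * c2%:Z) - rt * c1%:Z)%R.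
  by rewrite /z' !mulrDr Ez {1}sE {1}tE; ring.
clear sE tE; clearbody rs rt x' y' z'.
(* By r1 + r2 = - r3, s r1 + t r2 is (s - t) r1 - t r3 and (t - s) r2 - s r3;
   exchanging l and m turns the second case into the first. *)
have [le_ts|lt_st] := leP rt rs.
  have := @triangle_no_lattice_point _ _ _ _ _ _ _ _ _ _ _ _ H
    E%:Z%R x' y' z' (rs - rt)%R rt.
  case; rewrite ?Ex' ?Ey' ?Ez' ?sa ?sb ?sc ?PoszD; [lia..|ring|ring|ring|lia].
have := @triangle_no_lattice_point _ _ _ _ _ _ _ _ _ _ _ _
  (positive_herzog_mirror H) E%:Z%R y' x' z' (rt - rs)%R rs.
case; rewrite ?Ex' ?Ey' ?Ez' ?sa ?sb ?sc ?PoszD; [lia..|ring|ring|ring|lia].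
Qed.

Lemma herzog_H1_gens {l m n a b c a1 a2 b1 b2 c1 c2} :
  gcdn (gcdn l m) n = 1 ->
  positive_herzog l m n a b c a1 a2 b1 b2 c1 c2 ->
  [/\ l = b1 * c1 + b1 * c2 + b2 * c2,
      m = a1 * c1 + a2 * c1 + a2 * c2
    & n = a1 * b1 + a1 * b2 + a2 * b2].
Proof.
move=> g1 H.
have [sa sb sc] := coeff_sum H.
have sat := relations_saturated H.
case: H => -[l0 m0 n0] [[_ _ mina] _ _] [R1 R2 R3] [[? ?] [? ?] [? ?]].
rewrite sa in R1; rewrite sb in R2; rewrite sc in R3.
set l' := b1 * c1 + _ + _; set m' := a1 * c1 + _ + _.
set n' := a1 * b1 + _ + _.
have lm : l' * m = m' * l.
  have := congr1 (muln c1) R1; have := congr1 (muln c2) R2.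
  by rewrite /l' /m'; lia.
have ln : l' * n = n' * l.
  have := congr1 (muln b) R1; have := congr1 (muln b1) R2.
  by rewrite /l' /n' sb; lia.
have mn : m' * n = n' * m.
  have := congr1 (muln a2) R1; have := congr1 (muln a) R2.
  by rewrite /m' /n' sa; lia.
have [] := proportional_gcd g1 lm ln mn.
move: (gcdn _ _) => e l'E m'E n'E.
have n'0 : 0 < n' by rewrite /n' !addn_gt0 !muln_gt0; lia.
have e0 : 0 < e by case: (e) n'E n'0 => // ->.
(* Eliminating one coordinate at a time: a2 r1 + a r2 = e (0, n, -m),
   b r1 + b1 r2 = e (n, 0, -l) and c1 r1 - c2 r2 = e (m, -l, 0). *)
have /(_ e 0%R (n%:Z)%R (- m%:Z)%R (a2%:Z)%R (a%:Z)%R e0) := sat.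
case=> [|||_ /dvdnP[ka aE]]; [ring| | |].
- have -> : (e%:Z * n%:Z = n'%:Z)%R by rewrite n'E.
  by rewrite /n' sa sb; lia.
- have -> : (e%:Z * - m%:Z = - m'%:Z)%R by rewrite m'E PoszM mulrN.
  by rewrite /m' sa; lia.
have /(_ e (n%:Z)%R 0%R (- l%:Z)%R (b%:Z)%R (b1%:Z)%R e0) := sat.
case=> [| ||_ /dvdnP[kb b1E]]; [|ring| |].
- have -> : (e%:Z * n%:Z = n'%:Z)%R by rewrite n'E.
  by rewrite /n' sa sb; lia.
- have -> : (e%:Z * - l%:Z = - l'%:Z)%R by rewrite l'E PoszM mulrN.
  by rewrite /l' sb; lia.
have /(_ e (m%:Z)%R (- l%:Z)%R 0%R (c1%:Z)%R (- c2%:Z)%R e0) := sat.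
case=> [| ||_]; [| |ring|].
- have -> : (e%:Z * m%:Z = m'%:Z)%R by rewrite m'E.
  by rewrite /m' sa; lia.
- have -> : (e%:Z * - l%:Z = - l'%:Z)%R by rewrite l'E PoszM mulrN.
  by rewrite /l' sb; lia.
rewrite dvdzE abszN => /dvdnP[kc c2E].
have /mina : 0 < ka by case: (ka) aE => //; lia.
have relk : in_span2 m n (ka * l).
  exists kb, kc; apply/eqP; rewrite -(eqn_pmul2l e0) mulnDr !mulnA.
  by rewrite ![e * _]mulnC -aE -b1E -c2E sa R1.
move=> /(_ relk) leka.
have e1 : e = 1.
  have a0 : 0 < a by lia.
  by move: aE a0 leka => /= ->; clear - e0; nia.
by rewrite l'E m'E n'E e1 !mul1n.
Qed.

(** * Case (H1): from the formulas to the semigroup *)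

(** For a relation w = (j, -u, -v), the vectors x = w x r2 and y = r3 x w are
    cross products of relations, hence proportional to (l, m, n). As they are
    nonnegative and gcd(l, m, n) = 1, they are s (l, m, n) and s' (l, m, n) with
    natural numbers s and s', positive because x2 and y3 are. The combination
    a1 x3 + a2 y3 = j n gives j = s a1 + s' a2 >= a1 + a2. *)
Lemma herzog_min_multiple {a1 a2 b1 b2 c1 c2} :
  0 < a1 -> 0 < a2 -> 0 < b1 -> 0 < b2 -> 0 < c1 -> 0 < c2 ->
  let l := b1 * c1 + b1 * c2 + b2 * c2 in
  let m := a1 * c1 + a2 * c1 + a2 * c2 in
  let n := a1 * b1 + a1 * b2 + a2 * b2 in
  gcdn (gcdn l m) n = 1 -> min_multiple l m n (a1 + a2).
Proof.
move=> a10 a20 b10 b20 c10 c20 l m n g1; split; first by lia.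
  by exists b1, c2; rewrite /l /m /n; lia.
move=> j j0 [u [v rel]].
have n0 : 0 < n by rewrite /n !addn_gt0 !muln_gt0; lia.
have m0 : 0 < m by rewrite /m !addn_gt0 !muln_gt0; lia.
have R2 : (b1 + b2) * m = a2 * l + c1 * n by rewrite /l /m /n; lia.
have R3 : (c1 + c2) * n = a1 * l + b2 * m by rewrite /l /m /n; lia.
(* The coordinates x3 and y2 of the cross products are differences; that
   they are nonnegative is seen after multiplication by m, respectively n. *)
have [x3 x3E] : exists x3, j * (b1 + b2) = u * a2 + x3.
  exists (j * (b1 + b2) - u * a2); rewrite subnKC // -(leq_pmul2r m0).
  have := congr1 (muln a2) rel; have := congr1 (muln j) R2; lia.
have [y2 y2E] : exists y2, j * (c1 + c2) = v * a1 + y2.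
  exists (j * (c1 + c2) - v * a1); rewrite subnKC // -(leq_pmul2r n0).
  have := congr1 (muln a1) rel; have := congr1 (muln j) R3; lia.
pose x1 := u * c1 + v * (b1 + b2); pose x2 := v * a2 + j * c1.
pose y1 := v * b2 + u * (c1 + c2); pose y3 := u * a1 + j * b2.
have := congr1 (muln c1) rel; have := congr1 (muln v) R2.
have := congr1 (muln (b1 + b2)) rel; have := congr1 (muln a2) rel.
have := congr1 (muln j) R2; have := congr1 (muln u) R2.
have := (congr1 (muln^~ l) x3E, congr1 (muln^~ m) x3E).
move=> -[/= x3l x3m] R2u R2j rela2 relb R2v relc1.
have [_ x2E x3E'] := @proportional_gcd l m n x1 x2 x3 g1
  ltac:(rewrite /x1 /x2; lia) ltac:(rewrite /x1; lia) ltac:(rewrite /x2; lia).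
have := (congr1 (muln^~ l) y2E, congr1 (muln^~ n) y2E).
have := congr1 (muln a1) rel; have := congr1 (muln v) R3.
have := congr1 (muln (c1 + c2)) rel; have := congr1 (muln b2) rel.
have := congr1 (muln j) R3; have := congr1 (muln u) R3.
move=> R3u R3j relb2 relc R3v rela1 [/= y2l y2n].
have [_ _ y3E] := @proportional_gcd l m n y1 y2 y3 g1
  ltac:(rewrite /y1; lia) ltac:(rewrite /y1 /y3; lia) ltac:(rewrite /y3; lia).
set s := gcdn _ x3 in x2E x3E'; set s' := gcdn _ y3 in y3E; clearbody s s'.
have s0 : 0 < s.
  by have: 0 < s * m; [rewrite -x2E addn_gt0 !muln_gt0 j0 c10 orbT | case: (s)].
have s'0 : 0 < s'.
  by have: 0 < s' * n;
    [rewrite -y3E addn_gt0 !muln_gt0 j0 b20 orbT | case: (s')].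
have -> : j = s * a1 + s' * a2.
  apply/eqP; rewrite -(eqn_pmul2r n0) mulnDl mulnAC (mulnAC s') -x3E' -y3E.
  by have := congr1 (muln a1) x3E; rewrite /y3 /n; lia.
by rewrite leq_add ?leq_pmull.
Qed.
Lemma arises_H1_positive {l m n a1 a2 b1 b2 c1 c2} :
  arises_H1 l m n a1 a2 b1 b2 c1 c2 ->
  gcdn (gcdn l m) n = 1 /\
  exists a b c, positive_herzog l m n a b c a1 a2 b1 b2 c1 c2.
Proof.
case=> -[[l0 m0 n0 g1] [a [b [c [mins R1 R2 R3]]]]].
rewrite !inE !negb_or => /and5P[a10 a20 b10 b20 /andP[c10 c20]].
split=> //; exists a, b, c; split=> //.
by split; split; rewrite lt0n eq_sym.
Qed.

Lemma arises_H1_of_coprime {a1 a2 b1 b2 c1 c2} :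
  0 < a1 -> 0 < a2 -> 0 < b1 -> 0 < b2 -> 0 < c1 -> 0 < c2 ->
  let l := b1 * c1 + b1 * c2 + b2 * c2 in
  let m := a1 * c1 + a2 * c1 + a2 * c2 in
  let n := a1 * b1 + a1 * b2 + a2 * b2 in
  gcdn (gcdn l m) n = 1 -> arises_H1 l m n a1 a2 b1 b2 c1 c2.
Proof.
move=> a10 a20 b10 b20 c10 c20 l m n g1.
have mE : m = c1 * a1 + c1 * a2 + c2 * a2 by rewrite /m; lia.
have lE : l = c1 * b1 + c2 * b1 + c2 * b2 by rewrite /l; lia.
have nE : n = b1 * a1 + b2 * a1 + b2 * a2 by rewrite /n; lia.
split; last by rewrite !inE !negb_or; lia.
split; first by split=> //; rewrite !addn_gt0 !muln_gt0; lia.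
exists (a1 + a2), (b1 + b2), (c1 + c2); split; try by rewrite /l /m /n; lia.
split.
- exact: herzog_min_multiple.
- apply: min_multipleC.
  have := herzog_min_multiple b10 b20 c10 c20 a10 a20.
  by rewrite /= -mE -nE; apply; rewrite gcdnC gcdnA.
- have := herzog_min_multiple c10 c20 a10 a20 b10 b20.
  by rewrite /= -lE -mE; apply; rewrite -gcdnA gcdnC.
Qed.

(** * Case (H2) *)

(** Dividing a l = b m by gcd(a, b) would give a smaller multiple of l. *)
Lemma min_multiples_coprime {l m n a b} :
  0 < l -> 0 < m -> min_multiple l m n a -> min_multiple m l n b ->
  a * l = b * m -> coprime a b.
Proof.
move=> l0 m0 [a0 _ mina] [b0 _ _] ab.
have g0 : 0 < gcdn a b by rewrite gcdn_gt0 a0.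
have ag0 : 0 < a %/ gcdn a b by rewrite divn_gt0 // dvdn_leq ?dvdn_gcdl.
have : in_span2 m n (a %/ gcdn a b * l).
  exists (b %/ gcdn a b), 0.
  by rewrite addn0 -!(mulnC l) -(mulnC m) !muln_divA ?dvdn_gcdl ?dvdn_gcdr //
     (mulnC l) ab mulnC.
move/(mina _ ag0); rewrite /coprime leqNgt.
case: (gcdn a b =P 1) => // /eqP g1.
by rewrite ltn_Pdiv // ltn_neqAle eq_sym g1 g0.
Qed.

Lemma fraction_eqP {n d s c : nat} :
  0 < d -> 0 < c ->
  (n%:Q / d%:Q = s%:Q / c%:Q)%R <-> c * n = d * s.
Proof.
move=> d0 c0.
have dn0 : (d%:Q != 0)%R by rewrite intr_eq0; lia.
have cn0 : (c%:Q != 0)%R by rewrite intr_eq0; lia.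
split=> [|E]; last first.
  by apply/eqP; rewrite eqr_div // -!intrM; apply/eqP; congr (_%:~R)%R; lia.
by move/eqP; rewrite eqr_div // -!intrM => /eqP/intr_inj; lia.
Qed.

(** Take q < b with q a = n modulo b. Were q a > n, then q a d would be n d plus
    a multiple of b d, so q (a d) would lie in <b d, n> with 0 < q < b. *)
Lemma generator_in_span {a b d n} :
  0 < b -> 0 < d -> coprime a b -> min_multiple (a * d) (b * d) n b ->
  in_span2 b a n.
Proof.
move=> b0 d0 cab [_ _ minb].
have [q qb qn] : exists2 q, q < b & q * a = n %[mod b].
  have cba : coprime b a by rewrite coprime_sym.
  have /dvdnP[q qE] : a %| chinese b a n 0.
    by rewrite /dvdn (chinese_modr cba) mod0n.
  exists (q %% b); first by rewrite ltn_pmod.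
  by rewrite modnMml -qE (chinese_modl cba).
have [qan|nqa] := leqP (q * a) n.
  have : b %| n - q * a by rewrite -eqn_mod_dvd // qn.
  by case/dvdnP=> p pE; exists p, q; lia.
have : b %| q * a - n by rewrite -eqn_mod_dvd ?(ltnW nqa) // qn.
case/dvdnP=> p pE.
have q0 : 0 < q by case: (q) nqa.
have : b <= q.
  by apply: minb => //; exists p, d; have := congr1 (muln d) pE; nia.
by rewrite leqNgt qb.
Qed.

(** Elements of <b d, a d> are divisible by d, and n is prime to d. *)
Lemma min_multiple_d {a b d n} :
  0 < d -> coprime n d -> in_span2 b a n -> min_multiple n (b * d) (a * d) d.
Proof.
move=> d0 cnd [u [v nE]]; split=> //; first by exists u, v; rewrite nE; lia.
move=> j j0 [x [y jE]]; apply: dvdn_leq => //.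
rewrite -(@Gauss_dvdl _ j n) 1?coprime_sym //.
by apply/dvdnP; exists (x * b + y * a); rewrite jE; lia.
Qed.

Lemma gcdz3_eq1 {x y c : int} :
  (forall g : nat, (g%:Z %| x)%Z -> (g%:Z %| y)%Z -> (g%:Z %| c)%Z -> g = 1) ->
  gcdz (gcdz x y) c = 1%Z.
Proof.
move=> H; congr Posz; apply: H.
- exact: dvdz_trans (dvdz_gcdl _ _) (dvdz_gcdl _ _).
- exact: dvdz_trans (dvdz_gcdl _ _) (dvdz_gcdr _ _).
- exact: dvdz_gcdr.
Qed.

(** The interval for q is the range in which the shifted relation
    (a1 - q a) l + (b2 + q b) m = c n has natural coefficients. *)
Lemma shift_interval {a b a1 b2 : nat} (q : int) :
  0 < a -> 0 < b ->
  (- (b2%:Q / b%:Q) <= q%:Q <= a1%:Q / a%:Q)%R =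
  ((0 <= b2%:Z + q * b%:Z)%R && (0 <= a1%:Z - q * a%:Z)%R).
Proof.
move=> a0 b0.
have a0Q : (0 < a%:Q)%R by rewrite ltr0z.
have b0Q : (0 < b%:Q)%R by rewrite ltr0z.
rewrite -mulNr ler_pdivrMr // ler_pdivlMr // -mulrNz -!intrM !ler_int.
by congr (_ && _); lia.
Qed.

(** A common divisor g of the coefficients of a shifted relation can be divided
    out, leaving a relation for (c / g) n. *)
Lemma arises_H2_gcd {l m n a b c a1 b2} :
  arises_H2 l m n a b c a1 b2 -> forall q : int,
  (0 <= b2%:Z + q * b%:Z)%R -> (0 <= a1%:Z - q * a%:Z)%R ->
  gcdz (gcdz (- a1%:Z + q * a%:Z)%R (- b2%:Z - q * b%:Z)%R) c%:Z = 1%Z.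
Proof.
case=> _ [_ _ [c0 _ minc]] ab rel q v0 u0.
apply: gcdz3_eq1 => g /dvdzP[u uE] /dvdzP[v vE] /dvdnP[k /= cE].
have g0 : 0 < g by rewrite lt0n; apply/eqP=> gE; move: cE; rewrite gE; lia.
have gz : (0 < g%:Z :> int)%R by [].
have u'0 : (0 <= - u)%R by rewrite -(pmulr_lge0 _ gz) mulNr -uE; lia.
have v'0 : (0 <= - v)%R by rewrite -(pmulr_lge0 _ gz) mulNr -vE; lia.
have [un uN] : exists w : nat, (u = - w%:Z)%R by exists `|u|%N; lia.
have [vn vN] : exists w : nat, (v = - w%:Z)%R by exists `|v|%N; lia.
have : c <= k.
  apply: minc; first by case: (k) cE c0 => //; lia.
  exists un, vn; apply/eqP; rewrite -(eqn_pmul2l g0).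
  have : (g%:Z * (un%:Z * l%:Z + vn%:Z * m%:Z) = c%:Z * n%:Z)%R.
    transitivity ((a1%:Z - q * a%:Z) * l%:Z + (b2%:Z + q * b%:Z) * m%:Z)%R.
      have -> : (a1%:Z - q * a%:Z = un%:Z * g%:Z)%R.
        by move: uE; rewrite uN; lia.
      have -> : (b2%:Z + q * b%:Z = vn%:Z * g%:Z)%R.
        by move: vE; rewrite vN; lia.
      ring.
    have abz : (a%:Z * l%:Z = b%:Z * m%:Z)%R by lia.
    rewrite !mulrDl mulNr -!mulrA abz; lia.
  by rewrite cE; lia.
by move=> lek; clear - cE lek c0 g0; nia.
Qed.

(** From a l = b m and gcd(a, b) = 1: l = gcd(l a, l b) = gcd(b m, b l), so
    l is b gcd(l, m), and likewise m is a gcd(l, m). *)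
Lemma arises_H2_gens {l m n a b c a1 b2} :
  arises_H2 l m n a b c a1 b2 ->
  [/\ coprime a b, l = b * gcdn l m, m = a * gcdn l m,
      coprime n (gcdn l m) & c * n = gcdn l m * (a1 * b + a * b2)].
Proof.
case=> -[x1 [x2 [y1 [y2 [z1 [z2 [[[l0 m0 n0 g1] _] _]]]]]]].
move=> [mina minb _] ab rel.
have cab := min_multiples_coprime l0 m0 mina minb ab.
have lE : l = b * gcdn l m.
  rewrite -[LHS]muln1 -(eqP cab) !muln_gcdr gcdnC.
  by congr gcdn; [rewrite mulnC | rewrite mulnC ab].
have mE : m = a * gcdn l m.
  rewrite -[LHS]muln1 -(eqP cab) !muln_gcdr gcdnC.
  by congr gcdn; rewrite mulnC ?ab.
split=> //; first by rewrite /coprime gcdnC g1.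
by rewrite -rel {1}lE {2}mE; lia.
Qed.
Lemma coprime_fraction_eq {n d n' d' : nat} :
  coprime n d -> coprime n' d' -> n * d' = n' * d -> n = n' /\ d = d'.
Proof.
move=> cnd cnd' E.
have /eqP n_eq : n == n'.
  rewrite eqn_dvd -(@Gauss_dvdl n n' d) // -(@Gauss_dvdl n' n d') //.
  by rewrite -{1}E dvdn_mulr //= E dvdn_mulr.
have /eqP d_eq : d == d'.
  rewrite eqn_dvd -(@Gauss_dvdr d n d') 1?coprime_sym //.
  rewrite -(@Gauss_dvdr d' n' d) 1?coprime_sym //.
  by rewrite {1}E dvdn_mull //= -E dvdn_mull.
by [].
Qed.

(** By [generator_in_span], n = u b + v a, and d is the minimal multiplier, so
    c = k d. Then k (u b + v a) = a1 b + a b2 and gcd(a, b) = 1 give q with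
    a1 - q a = k u and b2 + q b = k v, and k = 1 by the gcd condition at q. *)
Lemma arises_H2_of_gcd {a b c a1 b2 d n} :
  0 < a -> 0 < b -> 0 < d -> coprime n d -> coprime a b ->
  c * n = d * (a1 * b + a * b2) -> subcase_H2 (b * d) (a * d) n ->
  (forall q : int, (0 <= b2%:Z + q * b%:Z)%R -> (0 <= a1%:Z - q * a%:Z)%R ->
    gcdz (gcdz (- a1%:Z + q * a%:Z)%R (- b2%:Z - q * b%:Z)%R) c%:Z = 1%Z) ->
  arises_H2 (b * d) (a * d) n a b c a1 b2.
Proof.
move=> a0 b0 d0 cnd cab cn [H2 [a' [b' [mina minb ab']]]] gcd1.
have ca'b' :=
  min_multiples_coprime (_ : 0 < b * d) (_ : 0 < a * d) mina minb ab'.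
have [a'a b'b] : a' = a /\ b' = b.
  apply: coprime_fraction_eq => //.
    by apply: ca'b'; rewrite muln_gt0; lia.
  by apply/eqP; rewrite -(eqn_pmul2r d0); lia.
rewrite {}a'a {}b'b {ab' ca'b'} in mina minb.
have nS := generator_in_span b0 d0 cab minb.
have minc := min_multiple_d d0 cnd nS.
have /dvdnP[k cE] : d %| c.
  by rewrite -(@Gauss_dvdl _ c n) 1?coprime_sym // cn dvdn_mulr.
have [u [v nE]] := nS.
have kE : k * (u * b + v * a) = a1 * b + a * b2.
  by apply/eqP; rewrite -(eqn_pmul2l d0) -cn cE nE; lia.
have kz : ((a1%:Z - k%:Z * u%:Z) * b%:Z = a%:Z * (k%:Z * v%:Z - b2%:Z))%R.
  by lia.
have /dvdzP[q qE] : (a%:Z %| (a1%:Z - k%:Z * u%:Z)%R)%Z.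
  by rewrite -(@Gauss_dvdzl _ _ b%:Z) // kz dvdz_mulr.
have qE' : (b2%:Z + q * b%:Z = k%:Z * v%:Z)%R.
  have aN0 : (a%:Z != 0)%R by rewrite -lt0n.
  apply: (mulfI aN0); move: kz; rewrite qE; lia.
have k1 : k = 1.
  have aE : (a1%:Z - q * a%:Z = k%:Z * u%:Z)%R by lia.
  have := gcd1 q; rewrite qE' aE => /(_ isT isT).
  have -> : (- a1%:Z + q * a%:Z = - u%:Z * k%:Z)%R by lia.
  have -> : (- b2%:Z - q * b%:Z = - v%:Z * k%:Z)%R by lia.
  move=> g1; apply/eqP; rewrite -[k == 1]/(absz (Posz k) == 1) -dvdz1 -g1.
  by rewrite !dvdz_gcd !dvdz_mull //= cE dvdzE dvdn_mulr.
have {k1 cE} cE : c = d by rewrite cE k1 mul1n.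
split=> //; first by split=> //; rewrite cE.
  by lia.
by rewrite cn; lia.
Qed.

Theorem proposition2p4 :
  (forall a1 a2 b1 b2 c1 c2 : nat,
     0 < a1 -> 0 < a2 -> 0 < b1 -> 0 < b2 -> 0 < c1 -> 0 < c2 ->
     let l' := b1 * c1 + b1 * c2 + b2 * c2 in
     let m' := a1 * c1 + a2 * c1 + a2 * c2 in
     let n' := a1 * b1 + a1 * b2 + a2 * b2 in
     let e' := gcdn (gcdn l' m') n' in
     ((exists l m n : nat, arises_H1 l m n a1 a2 b1 b2 c1 c2) <-> e' = 1) /\
     (forall l m n : nat, arises_H1 l m n a1 a2 b1 b2 c1 c2 ->
        (l, m, n) = (l', m', n')))
  /\
  (forall a b c a1 b2 : nat, 0 < a -> 0 < b -> 0 < c ->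
   forall l' m' n' d' : nat,
     l' = b * d' -> m' = a * d' ->
     (n'%:Q / d'%:Q = (a1%:Q * b%:Q + a%:Q * b2%:Q) / c%:Q)%R ->
     gcdn n' d' = 1 -> 1 <= d' ->
     ((exists l m n : nat, arises_H2 l m n a b c a1 b2) <->
      [/\ subcase_H2 l' m' n',
          gcdn a b = 1
        & forall q : int,
            (- (b2%:Q / b%:Q) <= q%:Q <= a1%:Q / a%:Q)%R ->
            gcdz (gcdz (- a1%:Z + q * a%:Z)%R (- b2%:Z - q * b%:Z)%R) c%:Z
            = 1%Z]) /\
     (forall l m n : nat, arises_H2 l m n a b c a1 b2 ->
        (l, m, n) = (l', m', n'))).
Proof.
split=> [a1 a2 b1 b2 c1 c2 a10 a20 b10 b20 c10 c20 l' m' n' e'|].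
  have gens l m n : arises_H1 l m n a1 a2 b1 b2 c1 c2 ->
      (l, m, n) = (l', m', n').
    move/arises_H1_positive=> [g1 [a [b [c H]]]].
    by have [-> -> ->] := herzog_H1_gens g1 H.
  split=> //; split=> [[l [m [n H]]]|e1].
    rewrite /e'; case: (gens l m n H) => <- <- <-.
    by case/arises_H1_positive: H.
  by exists l', m', n'; apply: arises_H1_of_coprime.
move=> a b c a1 b2 a0 b0 c0 l' m' n' d' -> -> frac /eqP cnd' d0.
have cn : c * n' = d' * (a1 * b + a * b2).
  by apply/(fraction_eqP d0 c0); rewrite frac PoszD !PoszM intrD !intrM.
have gens l m n : arises_H2 l m n a b c a1 b2 ->
    (l, m, n) = (b * d', a * d', n').
  case/arises_H2_gens=> _ lE mE cnd cn0.
  have [nn dd] : n = n' /\ gcdn l m = d'.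
    apply: coprime_fraction_eq => //.
    by apply/eqP; rewrite -(eqn_pmul2l c0) !mulnA cn cn0; lia.
  by rewrite -nn -dd -lE -mE.
split=> //; split=> [[l [m [n H]]]|[sub cab gcd1]].
  have [lE mE nE] := gens l m n H.
  split; last first.
  - by move=> q; rewrite shift_interval // => /andP[]; apply: (arises_H2_gcd H).
  - by have [/eqP] := arises_H2_gens H.
  case: H => H2 [mina minb _] ab _; rewrite -lE -mE -nE.
  by split=> //; exists a, b.
exists (b * d'), (a * d'), n'; apply: arises_H2_of_gcd => //; first exact/eqP.
by move=> q v0 u0; apply: gcd1; rewrite shift_interval // v0.
Qed.
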